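(* For positive integers $p,m$ and an integer $q\geq 2$, \begin{align*} &(-1)^{p-1} \sum_{\substack{i+j=m-1\\ i,j\geq 0}} \binom{p+i-1}{i}\binom{q+j-1}{j}\hat S_{p+i,q+j}+(-1)^{m-1}\sum_{\substack{i+j=p-1\\ i,j\geq 0}} \binom{m+i-1}{i}\binom{q+j-1}{j} T_{m+i,q+j}\\ &= \sum_{\substack{i+j=m-1\\ i,j\geq 0}} \binom{p+i-1}{i}\binom{q+j-1}{j}(-1)^i \widetilde{t}(p+i)\zeta(q+j)+ \sum_{\substack{i+j=p-1\\ i,j\geq 0}} \binom{m+i-1}{i}\binom{q+j-1}{j}(-1)^i \widetilde{t}(m+i)\widetilde{t}(q+j)\\ &\quad- \sum_{\substack{i+j=q-1\\ i,j\geq 0}} \binom{m+i-1}{i}\binom{p+j-1}{j}\zeta(m+i)\widetilde{t}(p+j), \end{align*} where $\zeta(1):=-2\log(2)$ and $\widetilde{t}(1):=0$.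
   Context: Let $h_n^{(p)}=\sum_{k=1}^n (k-1/2)^{-p}$ ($h_0^{(p)}=0$). Define $\hat S_{p,q}=\sum_{n\ge1}\frac{h_n^{(p)}}{n^q}$ and the Euler $T$-sum $T_{p,q}=\sum_{n\ge1}\frac{h_{n-1}^{(p)}}{(n-1/2)^q}$. For $s>1$, $\widetilde t(s)=\sum_{n\ge1}(n-1/2)^{-s}=(2^s-1)\zeta(s)$; $\zeta$ is the Riemann zeta function. *)

(* Defs.v *)
From HB Require Import structures.
From mathcomp Require Import all_boot all_order all_algebra.
From mathcomp Require Import all_classical all_reals all_analysis.
Set Implicit Arguments.
Unset Strict Implicit.
Unset Printing Implicit Defensive.
Import Order.TTheory GRing.Theory Num.Theory.
Import numFieldNormedType.Exports.
Local Open Scope classical_set_scope.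
Local Open Scope ring_scope.

Definition hsum (R : realType) (p n : nat) : R :=
  \sum_(1 <= k < n.+1) (k%:R - 2^-1) ^- p.

(* series u sums u from index 0: each sum over n >= 1 is shifted to n.+1,
   so that h_{n-1} in the T-sums becomes hsum R p n. *)
Definition Shat (R : realType) (p q : nat) : R :=
  limn [series hsum R p n.+1 / n.+1%:R ^+ q]_n.

Definition Tsum (R : realType) (p q : nat) : R :=
  limn [series hsum R p n / (n.+1%:R - 2^-1) ^+ q]_n.

(* At s = 1, where the series diverge, the values are the conventions
   zeta(1) := -2 log 2 and t~(1) := 0. Only s >= 1 is meaningful. *)
Definition zeta (R : realType) (s : nat) : R :=
  if s == 1%N then - 2 * ln 2 else limn [series (n.+1%:R : R) ^- s]_n.

Definition ttilde (R : realType) (s : nat) : R :=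
  if s == 1%N then 0 else limn [series (n.+1%:R - 2^-1 : R) ^- s]_n.

(* Sum of F i j over all i, j >= 0 with i + j = n. *)
Definition sum_antidiag (R : realType) (n : nat) (F : nat -> nat -> R) : R :=
  \sum_(i < n.+1) F i (n - i)%N.

(* Main.v *)
Require Import Defs.
From HB Require Import structures.
From mathcomp Require Import all_boot all_order all_algebra.
From mathcomp Require Import all_classical all_reals all_analysis.
From mathcomp Require Import ring lra.
Import Order.TTheory GRing.Theory Num.Theory.
Import numFieldNormedType.Exports.
Local Open Scope classical_set_scope.
Local Open Scope ring_scope.

(** The residues of 1 / ((a - s)^p (l - s)^m s^q) at s = 0, l and a add up to 0.
    Sum this identity over a = k - 1/2 and l with 1 <= k, l <= N. The residues
    at 0 give products of partial sums of zeta and t~. For fixed l the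
    differences a - l run through a symmetric block of half-integers, which
    gives h_l (hence the sums S^), plus h_{N-l}; the residues at a give the
    T-sums in the same way. Replacing h_{N-l} by h_N costs O(h_N^2 / N), which
    tends to 0. When p = 1 or m = 1 the divergent terms are all multiples of
    h_N^(1) and cancel; subtracting h_N^(1) from every divergent partial sum
    leaves t~(1) = 0 and zeta(1) = lim (H_N - h_N) = - 2 log 2. *)

(** * Partial fractions *)

Section PartialFractions.
Variable F : fieldType.
Implicit Types (x a l : F) (f g : nat -> F).

(** The coefficient of t^(n-1) in the product of the series with coefficients [f] and [g], that is,
    the residue at a pole of order [n]. The shifted index makes a pole of order 0 contribute 0. *)
Definition cauchyp (n : nat) f g : F := \sum_(i < n) f i * g (n.-1 - i)%N.

(* The coefficient of t^i in (x - t)^-p. *)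
Definition pcoef x (p i : nat) : F := 'C(p + i - 1, i)%:R * x ^- (p + i).

(* The coefficient of t^i in (x + t)^-p. *)
Definition ncoef x (p i : nat) : F := (-1) ^+ i * pcoef x p i.

Lemma cauchyp0 f g : cauchyp 0 f g = 0.
Proof. by rewrite /cauchyp big_ord0. Qed.

Lemma cauchypC (n : nat) f g : cauchyp n f g = cauchyp n g f.
Proof.
rewrite /cauchyp (reindex_inj rev_ord_inj) /=; apply: eq_bigr => i _.
case: n i => [|n] i; first by case: i.
by rewrite subSS /= subKn 1?mulrC // -ltnS.
Qed.

Lemma cauchypS (n : nat) f g :
  cauchyp n.+1 f g = f 0%N * g n + cauchyp n (f \o succn) g.
Proof.
rewrite /cauchyp big_ord_recl /= subn0; congr (_ + _).
apply: eq_bigr => i _; rewrite /= /bump /= add1n.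
by case: n i => [|n] i; [case: i | rewrite subSS].
Qed.

(** Truncated subtraction yields the constant series 1: the binomial is 'C(0, 0) at [i = 0] and 'C(i
    - 1, i) = 0 beyond. *)
Lemma pcoef0E x (i : nat) : pcoef x 0 i = (i == 0%N)%:R.
Proof.
rewrite /pcoef; case: i => [|i]; first by rewrite expr0 invr1 mulr1.
by rewrite add0n subn1 /= bin_small // mul0r.
Qed.

Lemma ncoef0E x (i : nat) : ncoef x 0 i = (i == 0%N)%:R.
Proof. by rewrite /ncoef pcoef0E; case: i => [|i]; rewrite ?expr0 ?mul1r ?mulr0. Qed.

Lemma pcoefSr0 x (p : nat) : x != 0 -> x * pcoef x p.+1 0 = pcoef x p 0.
Proof. by move=> x0; rewrite /pcoef !addn0 !bin0 !mul1r exprS invfM mulVKf. Qed.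

(** Compares coefficients in x (x - t)^-(p+1) = (x - t)^-p + t (x - t)^-(p+1); for the binomials
    this is Pascal's rule. *)
Lemma pcoefS x (p i : nat) : x != 0 ->
  x * pcoef x p.+1 i.+1 = pcoef x p i.+1 + pcoef x p.+1 i.
Proof.
move=> x0; rewrite /pcoef !addSn !addnS !subn1 /= binS natrD.
by rewrite [x ^+ _.+2]exprS invfM mulrCA mulVKf // mulrDl.
Qed.

Lemma cauchyp_delta (n : nat) f g : (forall i, f i = (i == 0%N)%:R) ->
  cauchyp n.+1 f g = g n.
Proof.
move=> fE; rewrite cauchypS fE mul1r /cauchyp big1 ?addr0 // => i _.
by rewrite /= fE mul0r.
Qed.

(** The relation of [pcoefS] times a series [g]; the factor t lowers the order of the pole from [n]
    to [n.-1]. *)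
Lemma cauchyp_pcoef x (p n : nat) g : x != 0 ->
  x * cauchyp n (pcoef x p.+1) g =
  cauchyp n (pcoef x p) g + cauchyp n.-1 (pcoef x p.+1) g.
Proof.
move=> x0; case: n => [|n]; first by rewrite !cauchyp0 mulr0 addr0.
rewrite !cauchypS mulrDr mulrA pcoefSr0 // -addrA; congr (_ + _).
rewrite /cauchyp mulr_sumr -big_split; apply: eq_bigr => i _ /=.
by rewrite mulrA pcoefS // mulrDl.
Qed.

(** The analogue for x (x + t)^-(p+1) = (x + t)^-p - t (x + t)^-(p+1). *)
Lemma cauchyp_ncoef x (p n : nat) g : x != 0 ->
  x * cauchyp n (ncoef x p.+1) g =
  cauchyp n (ncoef x p) g - cauchyp n.-1 (ncoef x p.+1) g.
Proof.
move=> x0; case: n => [|n]; first by rewrite !cauchyp0 mulr0 subr0.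
rewrite !cauchypS mulrDr mulrA /ncoef !expr0 !mul1r pcoefSr0 // -addrA; congr (_ + _).
rewrite /cauchyp mulr_sumr -sumrB; apply: eq_bigr => i _ /=.
by rewrite mulrA mulrCA pcoefS // exprS; ring.
Qed.

(* The residues of 1 / ((a - s)^p (l - s)^m s^q) at 0, l and a add up to 0. *)
Lemma partial_fractions a l (p m q : nat) :
  a != 0 -> l != 0 -> a != l -> (2 <= q)%N ->
  cauchyp q (pcoef l m) (pcoef a p) =
  cauchyp m (ncoef (a - l) p) (pcoef l q) + cauchyp p (ncoef (l - a) m) (pcoef a q).
Proof.
move=> a0 l0 al; case: q => [//|q] q1.
have al0 : a - l != 0 by rewrite subr_eq0.
have la0 : l - a != 0 by rewrite subr_eq0 eq_sym.
(* When [p = 0] or [m = 0] at most one pole besides 0 is left, and this binomial symmetry matches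
   its residue with the one at 0. *)
have pcoefC x (k n : nat) : pcoef x k.+1 n = pcoef x n.+1 k.
  by rewrite /pcoef !addSn !subn1 /= (addnC n k) -(bin_sub (leq_addl k n)) addnK.
elim: p m => [|p IHp] m.
  rewrite cauchypC cauchyp_delta ?cauchyp0 ?addr0; last exact: pcoef0E.
  (* For [p = m = 0] the only pole is at 0 and has order at least 2, so its residue vanishes. *)
  case: m => [|m]; first by rewrite cauchyp0 pcoef0E; case: q q1.
  by rewrite cauchyp_delta; [exact: pcoefC | exact: ncoef0E].
elim: m => [|m IHm].
  rewrite cauchyp_delta ?cauchyp0 ?add0r; last exact: pcoef0E.
  by rewrite cauchyp_delta; [exact: pcoefC | exact: ncoef0E].
(* Since a - l = (a - s) - (l - s), multiplying by a - l lowers one of the two exponents by one and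
   reduces the claim to both induction hypotheses. *)
have E1 : (a - l) * cauchyp q.+1 (pcoef l m.+1) (pcoef a p.+1) =
    cauchyp q.+1 (pcoef l m.+1) (pcoef a p) - cauchyp q.+1 (pcoef l m) (pcoef a p.+1).
  rewrite mulrBl (cauchyp_pcoef l) // cauchypC (cauchyp_pcoef a) //.
  by rewrite !(cauchypC _ (pcoef a _)); ring.
have E2 := cauchyp_ncoef (a - l) p m.+1 (pcoef l q.+1) al0.
have E3 := cauchyp_ncoef (l - a) m p.+1 (pcoef a q.+1) la0.
apply: (mulfI al0); rewrite E1 IHp IHm mulrDr E2 /=.
have -> : (a - l) * cauchyp p.+1 (ncoef (l - a) m.+1) (pcoef a q.+1) =
  - ((l - a) * cauchyp p.+1 (ncoef (l - a) m.+1) (pcoef a q.+1)) by ring.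
by rewrite E3 /=; ring.
Qed.

End PartialFractions.

(** * Partial sums and their limits *)

Section PowerSums.
Variable R : realType.
Implicit Types (s r N M k l n : nat) (b u : R^nat) (C : R).

Definition halfn n : R := n.+1%:R - 2^-1.

Definition zsum s N : R := \sum_(l < N) l.+1%:R ^- s.

Lemma halfn_gt0 n : 0 < halfn n.
Proof. by rewrite /halfn -[n.+1%:R]natr1; have := ler0n R n; lra. Qed.

Lemma halfn_neq0 n : halfn n != 0.
Proof. by rewrite gt_eqF ?halfn_gt0. Qed.

Lemma natS_gt0 n : 0 < n.+1%:R :> R.
Proof. by rewrite ltr0n. Qed.

Lemma hsumE s N : hsum R s N = \sum_(k < N) halfn k ^- s.
Proof. by rewrite /hsum big_add1 /= big_mkord. Qed.

Lemma hsumS s N : hsum R s N.+1 = hsum R s N + halfn N ^- s.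
Proof. by rewrite !hsumE big_ord_recr. Qed.

Lemma hsum0 s : hsum R s 0 = 0.
Proof. by rewrite hsumE big_ord0. Qed.

Lemma hsum_ge0 s N : 0 <= hsum R s N.
Proof.
rewrite hsumE; apply: sumr_ge0 => k _.
by rewrite invr_ge0 exprn_ge0 // ltW // halfn_gt0.
Qed.

Lemma hsumB s N M : (M <= N)%N ->
  hsum R s N - hsum R s M = \sum_(M <= k < N) halfn k ^- s.
Proof.
move=> MN; rewrite !hsumE -!(big_mkord xpredT (fun k => halfn k ^- s)).
by rewrite (big_cat_nat (leq0n M) MN) /= addrAC subrr add0r.
Qed.

Lemma halfn_sub k l : (l < k)%N -> halfn k - l.+1%:R = halfn (k - l.+1).
Proof.
by move=> lk; rewrite /halfn -[(k - l.+1).+1%:R]natr1 natrB // -natr1; ring.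
Qed.

Lemma halfn_sub_neg k l : (k <= l)%N -> halfn k - l.+1%:R = - halfn (l - k).
Proof.
move=> kl; rewrite /halfn -[(l - k).+1%:R]natr1 natrB //.
by rewrite -[k.+1%:R]natr1 -[l.+1%:R]natr1; lra.
Qed.

Lemma halfn_neq_nat k l : halfn k != l.+1%:R.
Proof.
rewrite -subr_eq0; case: (ltnP l k) => lk.
  by rewrite halfn_sub // halfn_neq0.
by rewrite halfn_sub_neg // oppr_eq0 halfn_neq0.
Qed.

Lemma exprVN (x : R) s : (- x) ^- s = (-1) ^+ s * x ^- s.
Proof. by rewrite -!exprVn invrN [in LHS]exprNn. Qed.

(** The differences are consecutive half-integers: [N - l.+1] positive ones from [k > l], and [l.+1]
    negative ones, in reverse order, from [k <= l]. *)
Lemma sum_halfn_sub s N l : (l < N)%N ->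
  \sum_(k < N) (halfn k - l.+1%:R) ^- s =
  hsum R s (N - l.+1) + (-1) ^+ s * hsum R s l.+1.
Proof.
move=> lN; rewrite -(big_mkord xpredT (fun k => (halfn k - l.+1%:R) ^- s)).
rewrite (big_cat_nat (n := l.+1)) //= addrC; congr (_ + _).
  rewrite -{1}[l.+1]add0n big_addn big_mkord hsumE; apply: eq_bigr => k _.
  by rewrite halfn_sub ?addnK // leq_addl.
rewrite big_mkord hsumE mulr_sumr (reindex_inj rev_ord_inj) /=.
apply: eq_bigr => k _.
by rewrite halfn_sub_neg subSS ?leq_subr // subKn ?exprVN // -ltnS.
Qed.

(** Here [l >= k] gives the [N - k] positive differences and [l < k] the [k] negative ones. The cut
    is one step earlier than in [sum_halfn_sub], whence h_(n-1) in the T-sums. *)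
Lemma sum_sub_halfn s N k : (k < N)%N ->
  \sum_(l < N) (l.+1%:R - halfn k) ^- s =
  hsum R s (N - k) + (-1) ^+ s * hsum R s k.
Proof.
move=> kN; rewrite -(big_mkord xpredT (fun l => (l.+1%:R - halfn k) ^- s)).
rewrite (big_cat_nat (n := k)) ?(ltnW kN) //= addrC; congr (_ + _).
  rewrite -{1}[k]add0n big_addn big_mkord hsumE; apply: eq_bigr => l _.
  by rewrite -opprB halfn_sub_neg ?opprK ?addnK // leq_addl.
rewrite big_mkord hsumE mulr_sumr (reindex_inj rev_ord_inj) /=.
apply: eq_bigr => l _.
rewrite -opprB halfn_sub ?exprVN.
  by congr (_ * halfn _ ^- _); rewrite -subSn // subSS subKn // ltnW.
by rewrite rev_ord_proof.
Qed.

(** * Growth of the odd harmonic numbers *)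

Lemma halfn_le n : halfn n <= n.+1%:R.
Proof. by rewrite /halfn; lra. Qed.

Lemma halfn_ge n : n.+1%:R / 2 <= halfn n.
Proof. by rewrite /halfn -[n.+1%:R]natr1; have := ler0n R n; lra. Qed.

Lemma halfn_ge2V n : 2^-1 <= halfn n.
Proof. by rewrite /halfn -[n.+1%:R]natr1; have := ler0n R n; lra. Qed.

Lemma hsum1S N : hsum R 1 N.+1 = hsum R 1 N + (halfn N)^-1.
Proof. by rewrite hsumS expr1. Qed.

Lemma halfn_inv_le n : (halfn n)^-1 <= 2 / n.+1%:R.
Proof.
rewrite -[2 / _]invrK invfM invrK mulrC lef_pV2 ?halfn_ge //.
  by rewrite posrE halfn_gt0.
by rewrite posrE divr_gt0 // natS_gt0.
Qed.

Lemma halfn_pow_le s n : halfn n ^- s.+1 <= 2 ^+ s * (halfn n)^-1.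
Proof.
rewrite exprS invfM mulrC ler_wpM2r ?invr_ge0 ?(ltW (halfn_gt0 _)) //.
rewrite -exprVn; apply: lerXn2r; rewrite ?nnegrE ?invr_ge0 ?(ltW (halfn_gt0 _)) //.
by rewrite -[2]invrK lef_pV2 ?halfn_ge2V // posrE ?halfn_gt0 // invr_gt0.
Qed.

Lemma hsumB_le s N M : (M <= N)%N ->
  hsum R s.+1 N - hsum R s.+1 M <= 2 ^+ s * (hsum R 1 N - hsum R 1 M).
Proof.
move=> MN; rewrite !hsumB // mulr_sumr; apply: ler_sum => k _.
by rewrite expr1 halfn_pow_le.
Qed.

Lemma hsum_le s N M : (M <= N)%N -> hsum R s M <= hsum R s N.
Proof.
move=> MN; rewrite -subr_ge0 hsumB //; apply: sumr_ge0 => k _.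
by rewrite invr_ge0 exprn_ge0 // ltW // halfn_gt0.
Qed.

Lemma halfn_mono M k : (M <= k)%N -> (halfn k)^-1 <= (halfn M)^-1.
Proof.
move=> Mk; rewrite lef_pV2 ?posrE ?halfn_gt0 // /halfn.
by rewrite lerD2r ler_nat ltnS.
Qed.

(* The averages of a decreasing sequence decrease. *)
Lemma hsum1_mean N M : (M <= N)%N -> M%:R * hsum R 1 N <= N%:R * hsum R 1 M.
Proof.
move=> MN.
have h1 : hsum R 1 N - hsum R 1 M <= (N - M)%:R * (halfn M)^-1.
  rewrite hsumB // mulr_natl -sumr_const_nat !big_nat.
  by apply: ler_sum => k /andP[Mk _]; rewrite expr1 halfn_mono.
have h2 : M%:R * (halfn M)^-1 <= hsum R 1 M.
  rewrite hsumE mulr_natl -[X in _ *+ X]card_ord -sumr_const.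
  by apply: ler_sum => k _; rewrite expr1 halfn_mono // ltnW.
have h3 := ler_wpM2l (ler0n R M) h1.
have h4 := ler_wpM2l (ler0n R (N - M)) h2.
rewrite natrB // in h3 h4; lra.
Qed.

(** Two Cesaro means. From 1/(n + 1/2) -> 0 follows h_n / n -> 0. With v = h_(n+1) - h_n <= 2/(n+1),
    the increments of h^2 are v (2 h_n + v) <= 4 h_(n+1) / (n+1), so they tend to 0 and so does
    their mean. *)
Lemma cvg_hsum1_sqr : hsum R 1 n.+1 ^+ 2 / n.+1%:R @[n --> \oo] --> (0 : R).
Proof.
have aux (h v x : R) : 0 <= h -> 0 < v -> v <= 2 * x ->
    0 <= (h + v - h) * (h + v + h) <= 4 * ((h + v) * x).
  move=> h0 v0 vx; apply/andP; split; first by apply: mulr_ge0; lra.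
  have : v * (h + v) <= 2 * x * (h + v) by apply: ler_wpM2r; lra.
  by have := mulr_ge0 (ltW v0) (ltW v0); lra.
have c0 : (halfn n)^-1 @[n --> \oo] --> (0 : R).
  apply: (@squeeze_cvgr _ _ _ _ (fun=> 0) (2 \*o harmonic)).
  - by near=> n; rewrite invr_ge0 ltW ?halfn_gt0 //= halfn_inv_le.
  - exact: cvg_cst.
  - rewrite -(mulr0 2); apply: cvgMl_tmp; exact: cvg_harmonic.
have c1 : hsum R 1 n.+1 / n.+1%:R @[n --> \oo] --> (0 : R).
  have := cesaro c0; apply: cvg_trans; apply: near_eq_cvg; near=> n.
  rewrite /arithmetic_mean /= mulrC hsumE seriesEord /=; congr (_ * _).
have c2 : (hsum R 1 n.+1 ^+ 2 - hsum R 1 n ^+ 2) @[n --> \oo] --> (0 : R).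
  apply: (@squeeze_cvgr _ _ _ _ (fun=> 0)
    (fun n => 4 * (hsum R 1 n.+1 / n.+1%:R))).
  - apply: nearW => n; rewrite subr_sqr.
    rewrite hsum1S; apply: aux; rewrite ?hsum_ge0 ?invr_gt0 ?halfn_gt0 //.
    exact: halfn_inv_le.
  - exact: cvg_cst.
  - rewrite -(mulr0 4); exact: cvgMl_tmp.
have := cesaro c2; apply: cvg_trans; apply: near_eq_cvg; near=> n.
rewrite /arithmetic_mean /= mulrC seriesEnat /= telescope_sumr //.
by rewrite hsum0 expr0n subr0.
Unshelve. all: by end_near.
Qed.

Lemma zsum1_le N : zsum 1 N <= hsum R 1 N.
Proof.
rewrite hsumE; apply: ler_sum => l _; rewrite !expr1.
by rewrite lef_pV2 ?halfn_le // posrE ?halfn_gt0 ?natS_gt0.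
Qed.

(* Replacing h_{N-l} by h_N costs at most a constant times h_N^2 / N. *)
Lemma cvg_shift_error b C s (g : nat -> nat -> nat) :
  (forall l, 0 <= b l <= C * l.+1%:R ^- 2) ->
  (forall N l, (l < N)%N -> (N - l.+1 <= g N l <= N)%N) ->
  \sum_(l < N) b l * (hsum R s.+1 N - hsum R s.+1 (g N l)) @[N --> \oo]
    --> (0 : R).
Proof.
move=> bC gN; rewrite -(cvg_shiftS _).
have C0 : 0 <= C
  by have /andP[b0 b1] := bC 0%N; have := le_trans b0 b1; rewrite expr1n invr1 mulr1.
apply: (@squeeze_cvgr _ _ _ _ (fun=> 0)
  (fun n => C * 2 ^+ s * (hsum R 1 n.+1 ^+ 2 / n.+1%:R))).
- near=> n; apply/andP; split.
    apply: sumr_ge0 => l _; apply: mulr_ge0; first by case/andP: (bC l).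
    by rewrite subr_ge0 hsum_le //; case/andP: (gN n.+1 l (ltn_ord l)).
  (* The remaining factor 1/(l+1) sums to at most h_N, which supplies the second factor of h_N^2 /
     N. *)
  have step (l : 'I_n.+1) :
      b l * (hsum R s.+1 n.+1 - hsum R s.+1 (g n.+1 l)) <=
      C * 2 ^+ s * (hsum R 1 n.+1 / n.+1%:R) * l.+1%:R^-1.
    have /andP[b0 bl] := bC l.
    have /andP[g1 g2] := gN n.+1 l (ltn_ord l).
    have h1 := hsumB_le s n.+1 _ g2.
    have h2 := hsum_le 1 _ _ g1.
    have h3 := hsum1_mean n.+1 (n.+1 - l.+1) (leq_subr _ _).
    have n0 := natS_gt0 n; have l0 := natS_gt0 l.
    (* By [hsum1_mean], dropping the last l+1 of N terms loses at most the fraction (l+1)/N of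
       h_N. *)
    have h4 : hsum R 1 n.+1 - hsum R 1 (g n.+1 l) <=
              l.+1%:R * (hsum R 1 n.+1 / n.+1%:R).
      rewrite mulrA ler_pdivlMr //; rewrite natrB // in h3.
      have := ler_wpM2r (ltW n0) h2; lra.
    have h5 : 0 <= hsum R s.+1 n.+1 - hsum R s.+1 (g n.+1 l).
      by rewrite subr_ge0 hsum_le.
    apply: le_trans (ler_wpM2r h5 bl) _.
    have h6 : 0 <= C * l.+1%:R ^- 2 by rewrite (le_trans b0).
    apply: le_trans (ler_wpM2l h6 h1) _.
    have h7 : 0 <= C * l.+1%:R ^- 2 * 2 ^+ s by rewrite mulr_ge0 // exprn_ge0.
    rewrite [X in X <= _]mulrA; apply: le_trans (ler_wpM2l h7 h4) _.
    rewrite le_eqVlt; apply/orP; left; apply/eqP; field.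
    by rewrite !gt_eqF.
  apply: (@le_trans _ _ (\sum_(l < n.+1)
      C * 2 ^+ s * (hsum R 1 n.+1 / n.+1%:R) * l.+1%:R^-1)).
    by apply: ler_sum => l _; exact: step.
  rewrite -mulr_sumr -mulrA; apply: ler_wpM2l; first by rewrite mulr_ge0 ?exprn_ge0.
  rewrite expr2 [X in _ <= X]mulrAC; apply: ler_wpM2l.
    by rewrite divr_ge0 ?hsum_ge0.
  by have := zsum1_le n.+1; rewrite /zsum; under eq_bigr do rewrite expr1.
- exact: cvg_cst.
- rewrite -(mulr0 (C * 2 ^+ s)); apply: cvgMl_tmp; exact: cvg_hsum1_sqr.
Unshelve. all: by end_near.
Qed.

(** * Convergence of the series *)

Lemma series_hsum1_le N :
  \sum_(n < N) hsum R 1 n.+1 * n.+1%:R ^- 2 <=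
  8 * (1 - N.+1%:R^-1) - 2 * (hsum R 1 N / N.+1%:R).
Proof.
(* The right-hand side stays below 8 and is chosen so that its increments dominate the terms; the
   correction -2 h_N / (N+1) absorbs the growth of h_N. *)
elim: N => [|N IH]; first by rewrite big_ord0 hsum0 mul0r mulr0 invr1 !subrr mulr0.
rewrite big_ord_recr /=; apply: le_trans (lerD IH (lexx _)) _.
have n0 := natS_gt0 N; have n1 := natS_gt0 N.+1.
have h0 := hsum_ge0 1 N.+1; rewrite hsum1S in h0 *.
have v1 := halfn_inv_le N; have := halfn_gt0 N; rewrite -invr_gt0 => v0.
set v := (halfn N)^-1 in v0 v1 h0 *; set h := hsum R 1 N in h0 *.
have -> : N.+2%:R = N.+1%:R + 1 :> R by rewrite -natr1.
have x1 : 1 <= N.+1%:R :> R by rewrite ler1n.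
set x := N.+1%:R in v1 n0 x1 *.
have xv : x * v <= 2 by rewrite -ler_pdivlMl // mulrC.
rewrite -subr_ge0.
(* Since [x * v <= 2], the numerator is at least 8x - 4(x + 1) + (h + v)(x - 1), which is
   nonnegative for [x >= 1]; this is where the constant 8 suffices. *)
have -> : 8 * (1 - (x + 1)^-1) - 2 * ((h + v) / (x + 1)) -
   (8 * (1 - x^-1) - 2 * (h / x) + (h + v) * x ^- 2) =
  (8 * x + (h + v) * (x - 1) - 2 * (x * v) * (x + 1)) / (x ^+ 2 * (x + 1)).
  by field; rewrite !gt_eqF //; lra.
apply: divr_ge0; last by rewrite mulr_ge0 ?sqr_ge0 //; lra.
have : 0 <= (h + v) * (x - 1) by apply: mulr_ge0; lra.
by nra.
Qed.

Lemma cvg_series_hsum1 :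
  cvgn (series (fun n => hsum R 1 n.+1 * n.+1%:R ^- 2 : R)).
Proof.
apply: nondecreasing_is_cvgn.
  apply: nondecreasing_series => n _ _.
  by rewrite mulr_ge0 ?hsum_ge0 // invr_ge0 exprn_ge0.
exists 8 => _ [N _ <-]; rewrite seriesEord /=.
apply: le_trans (series_hsum1_le N) _.
have := hsum_ge0 1 N; have := natS_gt0 N; rewrite -invr_gt0 => x0 h0.
by move: x0 (mulr_ge0 h0 (ltW x0)); move: (N.+1%:R^-1) (hsum R 1 N) => x h; lra.
Qed.

(** The single comparison series with terms h_n / n^2 serves for zeta, t~, S^ and T alike. *)
Lemma cvg_series_dom u C :
  (forall n, 0 <= u n <= C * (hsum R 1 n.+1 * n.+1%:R ^- 2)) ->
  cvgn (series u).
Proof.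
move=> uC.
apply: (@series_le_cvg _ u (fun n => C * (hsum R 1 n.+1 * n.+1%:R ^- 2))).
- by move=> n; case/andP: (uC n).
- by move=> n; case/andP: (uC n); exact: le_trans.
- by move=> n; case/andP: (uC n).
- exact: (is_cvg_seriesZ (k := C) cvg_series_hsum1).
Qed.

Lemma natS_pow_le r n : (2 <= r)%N -> n.+1%:R ^- r <= n.+1%:R ^- 2 :> R.
Proof.
move=> r2; rewrite lef_pV2 ?posrE ?exprn_gt0 ?natS_gt0 //.
by rewrite ler_weXn2l // ler1n.
Qed.

Lemma halfn_pow_le2 r n : (2 <= r)%N -> halfn n ^- r <= 2 ^+ r * n.+1%:R ^- 2.
Proof.
move=> r2; apply: le_trans (ler_wpM2l _ (natS_pow_le r n r2)); last first.
  exact: exprn_ge0.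
rewrite -!exprVn -exprMn; apply: lerXn2r; rewrite ?nnegrE ?halfn_inv_le //.
by rewrite invr_ge0 ltW ?halfn_gt0.
Qed.

Lemma hsum1_ge2 n : 2 <= hsum R 1 n.+1.
Proof.
apply: le_trans (hsum_le 1 n.+1 1 isT).
by rewrite hsum1S hsum0 add0r /halfn le_eqVlt; apply/orP; left; apply/eqP; field.
Qed.

Lemma hsum_dom s N : hsum R s.+1 N <= 2 ^+ s * hsum R 1 N.
Proof. by have := hsumB_le s N 0 isT; rewrite !hsum0 !subr0. Qed.

Lemma cvg_zsum r : (2 <= r)%N -> zsum r N @[N --> \oo] --> zeta R r.
Proof.
move=> r2; rewrite /zeta; case: eqP r2 => [->//|_] r2.
have -> : (fun N => zsum r N) = series (fun n => n.+1%:R ^- r).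
  by apply/funext => N; rewrite seriesEord.
apply: (cvg_series_dom _ 1) => n; rewrite invr_ge0 exprn_ge0 //= mul1r.
apply: le_trans (natS_pow_le _ _ r2) _; rewrite ler_peMl ?invr_ge0 ?exprn_ge0 //.
by have := hsum1_ge2 n; lra.
Qed.

Lemma cvg_hsum r : (2 <= r)%N -> hsum R r N @[N --> \oo] --> ttilde R r.
Proof.
move=> r2; rewrite /ttilde; case: eqP r2 => [->//|_] r2.
have -> : (fun N => hsum R r N) = series (fun n => (n.+1%:R - 2^-1) ^- r).
  by apply/funext => N; rewrite seriesEord hsumE.
apply: (cvg_series_dom _ (2 ^+ r)) => n.
rewrite invr_ge0 exprn_ge0 ?(ltW (halfn_gt0 n)) //=.
apply: le_trans (halfn_pow_le2 _ _ r2) _; apply: ler_wpM2l; rewrite ?exprn_ge0 //.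
rewrite ler_peMl ?invr_ge0 ?exprn_ge0 //.
by have := hsum1_ge2 n; lra.
Qed.

Lemma cvg_Shat s r : (2 <= r)%N ->
  \sum_(l < N) hsum R s.+1 l.+1 * l.+1%:R ^- r @[N --> \oo] --> Shat R s.+1 r.
Proof.
move=> r2; rewrite /Shat.
have -> : (fun N => \sum_(l < N) hsum R s.+1 l.+1 * l.+1%:R ^- r) =
    [series hsum R s.+1 n.+1 / n.+1%:R ^+ r]_n.
  by apply/funext => N; rewrite seriesEord.
apply: (cvg_series_dom _ (2 ^+ s)) => n.
rewrite mulr_ge0 ?hsum_ge0 ?invr_ge0 ?exprn_ge0 //= mulrA.
by apply: ler_pM; rewrite ?hsum_ge0 ?invr_ge0 ?exprn_ge0 ?hsum_dom ?natS_pow_le.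
Qed.

Lemma cvg_Tsum s r : (2 <= r)%N ->
  \sum_(k < N) hsum R s.+1 k * halfn k ^- r @[N --> \oo] --> Tsum R s.+1 r.
Proof.
move=> r2; rewrite /Tsum.
have -> : (fun N => \sum_(k < N) hsum R s.+1 k * halfn k ^- r) =
    [series hsum R s.+1 n / (n.+1%:R - 2^-1) ^+ r]_n.
  by apply/funext => N; rewrite seriesEord.
apply: (cvg_series_dom _ (2 ^+ s * 2 ^+ r)) => n.
have p0 : 0 <= halfn n ^- r by rewrite invr_ge0 exprn_ge0 ?(ltW (halfn_gt0 n)).
rewrite mulr_ge0 ?hsum_ge0 //= mulrACA.
apply: ler_pM; rewrite ?hsum_ge0 ?halfn_pow_le2 //.
by apply: le_trans (hsum_le _ _ _ (leqnSn n)) _; exact: hsum_dom.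
Qed.

(** * The value zeta(1) = - 2 log 2 as a limit *)

Lemma hsum1D_zsum1 N : hsum R 1 N + zsum 1 N = 2 * zsum 1 N.*2.
Proof.
(* In terms of H_2N, h_N is twice the sum of the odd terms 1/(2k-1) and H_N is twice the sum of the
   even terms 1/(2k). *)
elim: N => [|N IH]; first by rewrite hsum0 /zsum !big_ord0 addr0 mulr0.
rewrite hsum1S doubleS /zsum !big_ord_recr /= -!/(zsum _ _) !expr1.
have -> : hsum R 1 N + (halfn N)^-1 + (zsum 1 N + N.+1%:R^-1) =
  (hsum R 1 N + zsum 1 N) + ((halfn N)^-1 + N.+1%:R^-1) by ring.
rewrite IH -addrA mulrDr; congr (_ + _).
have x0 := ler0n R N.
rewrite /halfn -!natr1 -mul2n natrM; field.
by rewrite !gt_eqF //; lra.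
Qed.

(** Both bounds are ln(1 + x) <= x, at x = -1/(n+2) and at x = 1/(n+1). *)
Lemma ln_step n : n.+2%:R^-1 <= ln n.+2%:R - ln (n.+1%:R : R) <= n.+1%:R^-1.
Proof.
have x0 := natS_gt0 n; have y0 := natS_gt0 n.+1.
have xy : n.+2%:R = n.+1%:R + 1 :> R by rewrite -natr1.
apply/andP; split.
  rewrite -lerN2 opprB -ln_div ?posrE //.
  have -> : n.+1%:R / n.+2%:R = 1 + - n.+2%:R^-1 :> R.
    by rewrite xy; field; rewrite gt_eqF // -xy.
  apply: le_ln1Dx; rewrite ltrN2 invf_lt1 // xy; lra.
rewrite -ln_div ?posrE //.
have -> : n.+2%:R / n.+1%:R = 1 + n.+1%:R^-1 :> R.
  by rewrite xy; field; rewrite gt_eqF.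
by apply: le_ln1Dx; rewrite (@lt_trans _ _ 0) ?invr_gt0 //; lra.
Qed.

Lemma zsum1_double n :
  ln 2 - n.+1%:R^-1 <= zsum 1 n.+1.*2 - zsum 1 n.+1 <= ln 2.
Proof.
have zB : zsum 1 n.+1.*2 - zsum 1 n.+1 = \sum_(n.+1 <= k < n.+1.*2) k.+1%:R^-1.
  rewrite /zsum -!(big_mkord xpredT (fun k => k.+1%:R ^- 1 : R)).
  rewrite (big_cat_nat (leq0n n.+1) (_ : _ <= n.+1.*2)%N) /=; last first.
    by rewrite -addnn leq_addr.
  by rewrite addrAC subrr add0r.
have x0 := natS_gt0 n.
have le2 : (n.+1 <= n.+1.*2)%N by rewrite -addnn leq_addr.
have lnd : ln n.+1.*2%:R = ln 2 + ln n.+1%:R :> R.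
  by rewrite -mul2n natrM lnM ?posrE.
apply/andP; split; rewrite zB.
  have : \sum_(n.+1 <= k < n.+1.*2) (ln k.+2%:R - ln k.+1%:R) <=
      \sum_(n.+1 <= k < n.+1.*2) k.+1%:R^-1 :> R.
    by apply: ler_sum => k _; case/andP: (ln_step k).
  rewrite (telescope_sumr (fun k => ln k.+1%:R : R)) //.
  (* The telescoped sum is ln(2n+3) - ln(n+2). Replacing n+2 by n+1 costs at most 1/(n+1), and 2n+3
     may be lowered to 2n+2. *)
  apply: le_trans; have /andP[_ h] := ln_step n.
  have aux (a b c d e : R) : a - b <= c -> d + b <= e -> d - c <= e - a by lra.
  by apply: aux h _; rewrite -lnd ler_ln ?posrE ?ler_nat ?ltr0n.
have : \sum_(n.+1 <= k < n.+1.*2) k.+1%:R^-1 <=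
    \sum_(n.+1 <= k < n.+1.*2) (ln k.+1%:R - ln k%:R) :> R.
  rewrite !big_nat; apply: ler_sum => -[//|k] _.
  by case/andP: (ln_step k).
move=> /le_trans; apply.
by rewrite (telescope_sumr (fun k => ln k%:R : R)) // lnd addrK.
Qed.

Lemma cvg_zsum1 : zsum 1 N - hsum R 1 N @[N --> \oo] --> zeta R 1.
Proof.
rewrite /zeta eqxx -(cvg_shiftS _).
(* Substitutes h_N = 2 H_2N - H_N, from [hsum1D_zsum1]. *)
have -> : (fun n => zsum 1 n.+1 - hsum R 1 n.+1) =
    (fun n => - 2 * (zsum 1 n.+1.*2 - zsum 1 n.+1)).
  apply/funext => n; have := hsum1D_zsum1 n.+1; lra.
apply: cvgMl_tmp.
apply: (@squeeze_cvgr _ _ _ _ (fun n => ln 2 - n.+1%:R^-1) (fun=> ln 2)).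
- by near=> n; exact: zsum1_double.
- rewrite -[X in _ --> X]subr0; apply: cvgB; first exact: cvg_cst.
  exact: cvg_harmonic.
- exact: cvg_cst.
Unshelve. all: by end_near.
Qed.

End PowerSums.

(** * The identity for partial sums *)

Local Notation bb a i b j :=
  ('C(a + i - 1, i)%:R * 'C(b + j - 1, j)%:R) (only parsing).

Section Antidiagonals.
Variable R : realType.
Implicit Types (n : nat) (F G : nat -> nat -> R).

Lemma eq_antidiag n F G : (forall i j, (i + j = n)%N -> F i j = G i j) ->
  sum_antidiag n F = sum_antidiag n G.
Proof. by move=> FG; apply: eq_bigr => i _; rewrite FG // subnKC // -ltnS. Qed.

Lemma antidiagD n F G : sum_antidiag n (fun i j => F i j + G i j) =
  sum_antidiag n F + sum_antidiag n G.
Proof. exact: big_split. Qed.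

Lemma antidiagB n F G : sum_antidiag n (fun i j => F i j - G i j) =
  sum_antidiag n F - sum_antidiag n G.
Proof. exact: sumrB. Qed.

Lemma antidiagZ n (c : R) F :
  sum_antidiag n (fun i j => c * F i j) = c * sum_antidiag n F.
Proof. by rewrite /sum_antidiag mulr_sumr. Qed.

Lemma antidiag_deltal n F :
  sum_antidiag n (fun i j => (i == 0%N)%:R * F i j) = F 0%N n.
Proof.
rewrite /sum_antidiag big_ord_recl subn0 mul1r big1 ?addr0 // => i _.
by rewrite mul0r.
Qed.

Lemma antidiag_deltar n F :
  sum_antidiag n (fun i j => (j == 0%N)%:R * F i j) = F n 0%N.
Proof.
rewrite /sum_antidiag big_ord_recr /= subnn mul1r big1 ?add0r // => i _.
by rewrite subn_eq0 leqNgt ltn_ord mul0r.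
Qed.

Lemma exchange_antidiag n N (F : nat -> nat -> nat -> nat -> R) :
  \sum_(k < N) \sum_(l < N) sum_antidiag n (F k l) =
  sum_antidiag n (fun i j => \sum_(k < N) \sum_(l < N) F k l i j).
Proof.
rewrite /sum_antidiag; under eq_bigr do rewrite exchange_big /=.
by rewrite exchange_big.
Qed.

Lemma cvg_antidiag n (F : nat -> nat -> nat -> R) G :
  (forall i j, F N i j @[N --> \oo] --> G i j) ->
  sum_antidiag n (F N) @[N --> \oo] --> sum_antidiag n G.
Proof. by move=> FG; apply: cvg_big => [|i _]; [exact: add_continuous | exact: FG]. Qed.

End Antidiagonals.

Section FiniteIdentity.
Variable R : realType.
Implicit Types (p m q N i j : nat).
Local Notation halfn := (halfn R).
Local Notation zsum := (zsum R).

(** Sums [partial_fractions] over the N by N square. The sum over k collapses in the residues at l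
    by [sum_halfn_sub], the sum over l in the residues at a by [sum_sub_halfn]. *)
Lemma sum_partial_fractions p m q N : (0 < q)%N ->
  sum_antidiag q (fun i j => bb m.+1 i p.+1 j *
    (zsum (m.+1 + i) N * hsum R (p.+1 + j) N)) =
  sum_antidiag m (fun i j => (-1) ^+ i * bb p.+1 i q.+1 j *
    \sum_(l < N) l.+1%:R ^- (q.+1 + j) *
      (hsum R (p.+1 + i) (N - l.+1) + (-1) ^+ (p.+1 + i) * hsum R (p.+1 + i) l.+1)) +
  sum_antidiag p (fun i j => (-1) ^+ i * bb m.+1 i q.+1 j *
    \sum_(k < N) halfn k ^- (q.+1 + j) *
      (hsum R (m.+1 + i) (N - k) + (-1) ^+ (m.+1 + i) * hsum R (m.+1 + i) k)).
Proof.
move=> q0.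
(* [cauchyp n.+1] unfolds to [sum_antidiag n], so [partial_fractions] has this type by
   conversion. *)
have PF (k l : nat) :
    sum_antidiag q (fun i j => pcoef R l.+1%:R m.+1 i * pcoef R (halfn k) p.+1 j) =
    sum_antidiag m (fun i j =>
      ncoef R (halfn k - l.+1%:R) p.+1 i * pcoef R l.+1%:R q.+1 j) +
    sum_antidiag p (fun i j =>
      ncoef R (l.+1%:R - halfn k) m.+1 i * pcoef R (halfn k) q.+1 j) :=
  @partial_fractions R (halfn k) l.+1%:R p.+1 m.+1 q.+1
  (halfn_neq0 R k) (lt0r_neq0 (natS_gt0 R l)) (halfn_neq_nat R k l) q0.
transitivity (\sum_(k < N) \sum_(l < N)
    sum_antidiag q (fun i j => pcoef R l.+1%:R m.+1 i * pcoef R (halfn k) p.+1 j)).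
  rewrite (exchange_antidiag _ q N
    (fun k l i j => pcoef R l.+1%:R m.+1 i * pcoef R (halfn k) p.+1 j)).
  apply: eq_antidiag => i j _.
  rewrite hsumE mulr_sumr mulr_sumr; apply: eq_bigr => k _.
  rewrite mulr_suml mulr_sumr; apply: eq_bigr => l _.
  by rewrite /pcoef; ring.
under eq_bigr do under eq_bigr do rewrite PF.
under eq_bigr do rewrite big_split /=.
rewrite big_split /=; congr (_ + _).
  rewrite (exchange_antidiag _ m N
    (fun k l i j => ncoef R (halfn k - l.+1%:R) p.+1 i * pcoef R l.+1%:R q.+1 j)).
  apply: eq_antidiag => i j _; rewrite exchange_big mulr_sumr.
  apply: eq_bigr => l _; rewrite -sum_halfn_sub // mulr_sumr mulr_sumr.
  by apply: eq_bigr => k _; rewrite /ncoef /pcoef; ring.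
rewrite (exchange_antidiag _ p N
  (fun k l i j => ncoef R (l.+1%:R - halfn k) m.+1 i * pcoef R (halfn k) q.+1 j)).
apply: eq_antidiag => i j _; rewrite mulr_sumr.
apply: eq_bigr => k _; rewrite -sum_sub_halfn // mulr_sumr mulr_sumr.
by apply: eq_bigr => l _; rewrite /ncoef /pcoef; ring.
Qed.

(* Subtracting the odd harmonic number h_N at exponent 1 produces the values
   t~(1) = 0 and zeta(1) = - 2 log 2 in the limit. *)
Definition hreg N s : R := hsum R s N - (s == 1%N)%:R * hsum R 1 N.
Definition zreg N s : R := zsum s N - (s == 1%N)%:R * hsum R 1 N.

Lemma deltaS p i : (p.+1 + i == 1)%N%:R = (p == 0%N)%:R * (i == 0%N)%:R :> R.
Proof. by rewrite addSn eqSS addn_eq0 -natrM mulnb. Qed.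

(** Exponent 1 occurs only for [p = 0] or [m = 0], at the end of an antidiagonal. The multiples of
    h_N^(1) split off there agree on both sides of the subtraction by symmetry of the binomials, so
    they cancel. *)
Lemma regularize p m q N : (0 < q)%N ->
  sum_antidiag m (fun i j => (-1) ^+ i * bb p.+1 i q.+1 j *
      (hsum R (p.+1 + i) N * zsum (q.+1 + j) N)) +
  sum_antidiag p (fun i j => (-1) ^+ i * bb m.+1 i q.+1 j *
      (hsum R (m.+1 + i) N * hsum R (q.+1 + j) N)) -
  sum_antidiag q (fun i j => bb m.+1 i p.+1 j *
      (zsum (m.+1 + i) N * hsum R (p.+1 + j) N)) =
  sum_antidiag m (fun i j => (-1) ^+ i * bb p.+1 i q.+1 j *
      (hreg N (p.+1 + i) * zsum (q.+1 + j) N)) +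
  sum_antidiag p (fun i j => (-1) ^+ i * bb m.+1 i q.+1 j *
      (hreg N (m.+1 + i) * hsum R (q.+1 + j) N)) -
  sum_antidiag q (fun i j => bb m.+1 i p.+1 j *
      (zreg N (m.+1 + i) * hreg N (p.+1 + j))).
Proof.
move=> q0; set c := hsum R 1 N.
have E a b (f : nat -> R) : sum_antidiag a (fun i j =>
      (-1) ^+ i * bb b.+1 i q.+1 j * (hsum R (b.+1 + i) N * f (q.+1 + j)%N)) =
    sum_antidiag a (fun i j =>
      (-1) ^+ i * bb b.+1 i q.+1 j * (hreg N (b.+1 + i) * f (q.+1 + j)%N)) +
    (b == 0%N)%:R * ('C(q + a, a)%:R * c * f (q + a).+1).
  have := antidiag_deltal R a (fun i j =>
    (-1) ^+ i * bb b.+1 i q.+1 j * (b == 0%N)%:R * c * f (q.+1 + j)%N).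
  rewrite expr0 addn0 bin0 addSn subn1 /= !mul1r => D.
  rewrite -mulrA mulrCA !mulrA -D -antidiagD; apply: eq_antidiag => i j _.
  by rewrite /hreg deltaS -/c; ring.
have E' : sum_antidiag q (fun i j => bb m.+1 i p.+1 j *
      (zsum (m.+1 + i) N * hsum R (p.+1 + j) N)) =
    sum_antidiag q (fun i j => bb m.+1 i p.+1 j *
      (zreg N (m.+1 + i) * hreg N (p.+1 + j))) +
    (m == 0%N)%:R * ('C(q + p, p)%:R * c * hsum R (q + p).+1 N) +
    (p == 0%N)%:R * ('C(q + m, m)%:R * c * zsum (q + m).+1 N).
  have := antidiag_deltal R q (fun i j =>
    bb m.+1 i p.+1 j * (m == 0%N)%:R * c * hsum R (p.+1 + j) N).
  have := antidiag_deltar R q (fun i j =>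
    bb m.+1 i p.+1 j * (p == 0%N)%:R * c * zsum (m.+1 + i) N).
  rewrite !addn0 !bin0 !addSn !subn1 /= mulr1 mul1r => D2 D1.
  have binC a : 'C(q + a, a) = 'C(a + q, q).
    by rewrite -(bin_sub (leq_addl q a)) addnK addnC.
  have -> : (m == 0%N)%:R * ('C(q + p, p)%:R * c * hsum R (q + p).+1 N) =
    'C(p + q, q)%:R * (m == 0%N)%:R * c * hsum R (p + q).+1 N.
    by rewrite binC (addnC q); ring.
  have -> : (p == 0%N)%:R * ('C(q + m, m)%:R * c * zsum (q + m).+1 N) =
    'C(m + q, q)%:R * (p == 0%N)%:R * c * zsum (m + q).+1 N.
    by rewrite binC (addnC q); ring.
  rewrite -D1 -D2 -!antidiagD; apply: eq_antidiag => i j ij.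
  (* The cross term in c^2 needs i = j = 0, which is excluded by i + j = q > 0. *)
  have ij0 : (i == 0%N)%:R * (j == 0%N)%:R = 0 :> R.
    by rewrite -natrM mulnb -addn_eq0 ij eqn0Ngt q0.
  rewrite /hreg /zreg !deltaS -/c.
  apply/eqP; rewrite -subr_eq0; apply/eqP.
  transitivity (- (bb m.+1 i p.+1 j * (m == 0%N)%:R * (p == 0%N)%:R * c ^+ 2 *
    ((i == 0%N)%:R * (j == 0%N)%:R))); first by ring.
  by rewrite ij0 mulr0 oppr0.
rewrite (E m p (fun s => zsum s N)) (E p m (fun s => hsum R s N)) E'.
by ring.
Qed.


(** [zerr] and [herr] measure the replacement of the reflected index by N, in the residues at
    integers and at half-integers respectively. *)
Definition zerr s r N : R :=
  \sum_(l < N) l.+1%:R ^- r * (hsum R s N - hsum R s (N - l.+1)).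
Definition herr s r N : R :=
  \sum_(k < N) halfn k ^- r * (hsum R s N - hsum R s (N - k)).
Definition Spart s r N : R := \sum_(l < N) hsum R s l.+1 * l.+1%:R ^- r.
Definition Tpart s r N : R := \sum_(k < N) hsum R s k * halfn k ^- r.

(** Writes h at [g k] as h_N minus an error and uses (-1)^i (-1)^(p+1+i) = -(-1)^p. The maps [g] and
    [h] are left free so that it applies to the residues at l and at a. *)
Lemma expand_residues n p q N (B f : nat -> nat -> R) (g h : nat -> nat) :
  sum_antidiag n (fun i j => (-1) ^+ i * B i j *
    \sum_(k < N) f (q.+1 + j)%N k *
      (hsum R (p.+1 + i) (g k) + (-1) ^+ (p.+1 + i) * hsum R (p.+1 + i) (h k))) =
  sum_antidiag n (fun i j => (-1) ^+ i * B i j *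
    (hsum R (p.+1 + i) N * \sum_(k < N) f (q.+1 + j)%N k)) -
  sum_antidiag n (fun i j => (-1) ^+ i * B i j *
    \sum_(k < N) f (q.+1 + j)%N k *
      (hsum R (p.+1 + i) N - hsum R (p.+1 + i) (g k))) -
  (-1) ^+ p * sum_antidiag n (fun i j => B i j *
    \sum_(k < N) hsum R (p.+1 + i) (h k) * f (q.+1 + j)%N k).
Proof.
rewrite -antidiagZ -!antidiagB; apply: eq_antidiag => i j _.
have sgn : (-1) ^+ p = - (-1) ^+ i * (-1) ^+ (p.+1 + i) :> R.
  by rewrite addSn exprS exprD mulN1r mulrNN mulrCA -expr2 sqrr_sign mulr1.
rewrite sgn !mulr_sumr -!sumrB.
by apply: eq_bigr => k _; move: ((-1) ^+ i) ((-1) ^+ (p.+1 + i)) => x y; ring.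
Qed.

(** Solves the summed identity for the S^ and T parts; after [regularize], each term on the right
    has a finite limit. *)
Lemma finite_identity p m q N : (0 < q)%N ->
  (-1) ^+ p * sum_antidiag m (fun i j =>
      bb p.+1 i q.+1 j * Spart (p.+1 + i) (q.+1 + j) N) +
  (-1) ^+ m * sum_antidiag p (fun i j =>
      bb m.+1 i q.+1 j * Tpart (m.+1 + i) (q.+1 + j) N) =
  sum_antidiag m (fun i j => (-1) ^+ i * bb p.+1 i q.+1 j *
      (hreg N (p.+1 + i) * zsum (q.+1 + j) N)) -
  sum_antidiag m (fun i j => (-1) ^+ i * bb p.+1 i q.+1 j *
      zerr (p.+1 + i) (q.+1 + j) N) +
  (sum_antidiag p (fun i j => (-1) ^+ i * bb m.+1 i q.+1 j *
      (hreg N (m.+1 + i) * hsum R (q.+1 + j) N)) -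
  sum_antidiag p (fun i j => (-1) ^+ i * bb m.+1 i q.+1 j *
      herr (m.+1 + i) (q.+1 + j) N)) -
  sum_antidiag q (fun i j => bb m.+1 i p.+1 j *
      (zreg N (m.+1 + i) * hreg N (p.+1 + j))).
Proof.
move=> q0.
have E1 := expand_residues m p q N (fun i j => bb p.+1 i q.+1 j)
  (fun r l => l.+1%:R ^- r) (fun l => N - l.+1)%N succn.
have E2 := expand_residues p m q N (fun i j => bb m.+1 i q.+1 j)
  (fun r k => halfn k ^- r) (fun k => N - k)%N id.
have E3 : sum_antidiag p (fun i j => (-1) ^+ i * bb m.+1 i q.+1 j *
    (hsum R (m.+1 + i) N * \sum_(k < N) halfn k ^- (q.+1 + j))) =
  sum_antidiag p (fun i j => (-1) ^+ i * bb m.+1 i q.+1 j *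
    (hsum R (m.+1 + i) N * hsum R (q.+1 + j) N)).
  by apply: eq_antidiag => i j _; rewrite -hsumE.
rewrite E3 in E2.
have aux (L L' U1 V1 U2 V2 U1' U2' P Q : R) : L = U1 - V1 - P + (U2 - V2 - Q) ->
  U1 + U2 - L = U1' + U2' - L' -> P + Q = U1' - V1 + (U2' - V2) - L' by lra.
apply: aux (regularize p m q N q0).
by rewrite (sum_partial_fractions p m q N q0); congr (_ + _).
Qed.

(** * Passage to the limit *)

Lemma cvg_hreg s : (0 < s)%N -> hreg N s @[N --> \oo] --> ttilde R s.
Proof.
rewrite leq_eqVlt /hreg => /predU1P[<-|s1].
  rewrite /ttilde eqxx; under eq_fun do rewrite mul1r subrr.
  exact: cvg_cst.
by rewrite gtn_eqF //; under eq_fun do rewrite mul0r subr0; exact: cvg_hsum.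
Qed.

Lemma cvg_zreg s : (0 < s)%N -> zreg N s @[N --> \oo] --> zeta R s.
Proof.
rewrite leq_eqVlt /zreg => /predU1P[<-|s1].
  by under eq_fun do rewrite mul1r; exact: cvg_zsum1.
by rewrite gtn_eqF //; under eq_fun do rewrite mul0r subr0; exact: cvg_zsum.
Qed.

Lemma cvg_zerr s r : (2 <= r)%N -> zerr s.+1 r N @[N --> \oo] --> (0 : R).
Proof.
move=> r2; apply: (cvg_shift_error R (fun l => l.+1%:R ^- r) 1 s
  (fun N l => N - l.+1)%N).
  by move=> l; rewrite invr_ge0 exprn_ge0 //= mul1r natS_pow_le.
by move=> N l _; rewrite leqnn leq_subr.
Qed.

Lemma cvg_herr s r : (2 <= r)%N -> herr s.+1 r N @[N --> \oo] --> (0 : R).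
Proof.
move=> r2; apply: (cvg_shift_error R (fun k => halfn k ^- r) (2 ^+ r) s
  (fun N k => N - k)%N).
  by move=> k; rewrite invr_ge0 exprn_ge0 ?(ltW (halfn_gt0 R k)) //= halfn_pow_le2.
by move=> N k _; rewrite leq_sub2l //= leq_subr.
Qed.

End FiniteIdentity.

Theorem theorem5p5 (R : realType) (p m q : nat)
    (hp : (1 <= p)%N) (hm : (1 <= m)%N) (hq : (2 <= q)%N) :
  (-1) ^+ (p - 1) * sum_antidiag (m - 1) (fun i j =>
      'C(p + i - 1, i)%:R * 'C(q + j - 1, j)%:R * Shat R (p + i) (q + j))
  + (-1) ^+ (m - 1) * sum_antidiag (p - 1) (fun i j =>
      'C(m + i - 1, i)%:R * 'C(q + j - 1, j)%:R * Tsum R (m + i) (q + j))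
  = sum_antidiag (m - 1) (fun i j =>
      'C(p + i - 1, i)%:R * 'C(q + j - 1, j)%:R * (-1) ^+ i
        * ttilde R (p + i) * zeta R (q + j))
  + sum_antidiag (p - 1) (fun i j =>
      'C(m + i - 1, i)%:R * 'C(q + j - 1, j)%:R * (-1) ^+ i
        * ttilde R (m + i) * ttilde R (q + j))
  - sum_antidiag (q - 1) (fun i j =>
      'C(m + i - 1, i)%:R * 'C(p + j - 1, j)%:R
        * zeta R (m + i) * ttilde R (p + j)).
Proof.
case: p hp => [//|p] _; case: m hm => [//|m] _; case: q hq => [//|q] q0.
rewrite !subn1 /=.
(* Exponents containing q are at least 2, so those factors converge as they are; only exponents
   starting at p or m need regularizing. *)
have q2 j : (2 <= q.+1 + j)%N by rewrite (leq_trans q0) // leq_addr.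
have cS : sum_antidiag m (fun i j => bb p.+1 i q.+1 j *
      Spart R (p.+1 + i) (q.+1 + j) N) @[N --> \oo] -->
    sum_antidiag m (fun i j => bb p.+1 i q.+1 j * Shat R (p.+1 + i) (q.+1 + j)).
  by apply: cvg_antidiag => i j; apply: cvgMl_tmp; exact: cvg_Shat.
have cT : sum_antidiag p (fun i j => bb m.+1 i q.+1 j *
      Tpart R (m.+1 + i) (q.+1 + j) N) @[N --> \oo] -->
    sum_antidiag p (fun i j => bb m.+1 i q.+1 j * Tsum R (m.+1 + i) (q.+1 + j)).
  by apply: cvg_antidiag => i j; apply: cvgMl_tmp; exact: cvg_Tsum.
have cU : sum_antidiag m (fun i j => (-1) ^+ i * bb p.+1 i q.+1 j *
      (hreg R N (p.+1 + i) * zsum R (q.+1 + j) N)) @[N --> \oo] -->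
    sum_antidiag m (fun i j => (-1) ^+ i * bb p.+1 i q.+1 j *
      (ttilde R (p.+1 + i) * zeta R (q.+1 + j))).
  apply: cvg_antidiag => i j; apply: cvgMl_tmp.
  by apply: cvgM; [exact: cvg_hreg | exact: cvg_zsum].
have cV : sum_antidiag m (fun i j => (-1) ^+ i * bb p.+1 i q.+1 j *
      zerr R (p.+1 + i) (q.+1 + j) N) @[N --> \oo] -->
    sum_antidiag m (fun i j => (-1) ^+ i * bb p.+1 i q.+1 j * 0).
  by apply: cvg_antidiag => i j; apply: cvgMl_tmp; exact: cvg_zerr.
have cU' : sum_antidiag p (fun i j => (-1) ^+ i * bb m.+1 i q.+1 j *
      (hreg R N (m.+1 + i) * hsum R (q.+1 + j) N)) @[N --> \oo] -->
    sum_antidiag p (fun i j => (-1) ^+ i * bb m.+1 i q.+1 j *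
      (ttilde R (m.+1 + i) * ttilde R (q.+1 + j))).
  apply: cvg_antidiag => i j; apply: cvgMl_tmp.
  by apply: cvgM; [exact: cvg_hreg | exact: cvg_hsum].
have cV' : sum_antidiag p (fun i j => (-1) ^+ i * bb m.+1 i q.+1 j *
      herr R (m.+1 + i) (q.+1 + j) N) @[N --> \oo] -->
    sum_antidiag p (fun i j => (-1) ^+ i * bb m.+1 i q.+1 j * 0).
  by apply: cvg_antidiag => i j; apply: cvgMl_tmp; exact: cvg_herr.
have cW : sum_antidiag q (fun i j => bb m.+1 i p.+1 j *
      (zreg R N (m.+1 + i) * hreg R N (p.+1 + j))) @[N --> \oo] -->
    sum_antidiag q (fun i j => bb m.+1 i p.+1 j *
      (zeta R (m.+1 + i) * ttilde R (p.+1 + j))).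
  apply: cvg_antidiag => i j; apply: cvgMl_tmp.
  by apply: cvgM; [exact: cvg_zreg | exact: cvg_hreg].
pose proof (cvgD (cvgMl_tmp (a := (-1) ^+ p) cS) (cvgMl_tmp (a := (-1) ^+ m) cT)) as cL.
pose proof (cvgB (cvgD (cvgB cU cV) (cvgB cU' cV')) cW) as cR.
(* Both sides of the finite identity are the same sequence in N, so the two limits coincide. *)
have FG := funext (fun N => finite_identity R p m q N q0).
have -> := cvg_unique (@norm_hausdorff _ R) cL
  (eq_ind_r (fun f : nat -> R => f @ \oo --> _) cR FG).
have z n (F : nat -> nat -> R) : sum_antidiag n (fun i j => F i j * 0) = 0.
  by rewrite /sum_antidiag big1 // => i _; rewrite mulr0.
rewrite !z !subr0; congr (_ + _ - _).
- by apply: eq_antidiag => i j _; ring.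
- by apply: eq_antidiag => i j _; ring.
- by apply: eq_antidiag => i j _; ring.
Qed.
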